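(* Let $E,A\in\mathbb{C}^{n\times n}$ and $B\in\mathbb{C}^{n\times m}$ with $B\neq 0$, and let $G(z)=(zE-A)^{-1}B$. Let $z_1,\ldots,z_S\in\mathbb{C}$ be distinct points such that $z_jE-A$ is invertible for all $j$, and let $q_1,\ldots,q_S\in\mathbb{C}\setminus\{0\}$. Consider the interpolatory rational approximation of $G$ $$\widetilde{G}(z)=\sum_{j=1}^S\frac{q_jG(z_j)}{z-z_j}\Bigg/\sum_{j=1}^S\frac{q_j}{z-z_j}.$$ Then there exists a constant $\gamma$, independent of $z$, such that the relative residual norm $$\rho(\widetilde{G},z)=\frac{\|(zE-A)\widetilde{G}(z)-B\|}{\|B\|}$$ satisfies $$\rho(\widetilde{G},z)=\gamma\left|\sum_{j=1}^S\frac{q_j}{z-z_j}\right|^{-1}$$ for all $z\in\mathbb{C}$ that are not poles of $\widetilde{G}$ in the sense that $\sum_{j=1}^S q_j/(z-z_j)\neq 0$ (with the convention in the context at $z=z_i$).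
   Context: $\|\cdot\|$ denotes the Frobenius norm of a matrix. $G$ is the state transfer function of the frequency-domain linear time-invariant descriptor system $zEX(z)=AX(z)+BU(z)$. At a support point $z_i$, the barycentric quotient is defined by removing the removable discontinuity, i.e. $\widetilde{G}(z_i):=\lim_{z\to z_i}\widetilde{G}(z)=G(z_i)$; correspondingly, $\left|\sum_{j=1}^S q_j/(z-z_j)\right|^{-1}$ is understood as its limit, $0$, at $z=z_i$, and $z=z_i$ is included among the admissible values of $z$. *)

(* Defs.v *)
From HB Require Import structures.
From mathcomp Require Import all_boot all_order all_algebra.
From mathcomp Require Import complex.
From mathcomp Require Import all_classical all_reals all_analysis.

Set Implicit Arguments.
Unset Strict Implicit.
Unset Printing Implicit Defensive.

Import Order.TTheory GRing.Theory Num.Theory.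
Import numFieldNormedType.Exports.
Import ComplexField.Normc.

Local Open Scope classical_set_scope.
Local Open Scope ring_scope.
Local Open Scope complex_scope.

(* The topology of R[i] is the one the library attaches to every
   numClosedFieldType, i.e. the one induced by the complex modulus; it has to
   be declared because R[i] is not a variable of a numeric structure. *)
HB.instance Definition _ (R : realType) := NormedModule.copy R[i] (R[i])^o.

Section Definitions.
Variable R : realType.
Local Notation C := R[i].

(* Modulus and norms are taken with values in R: normc : R[i] -> R. *)
Definition frobenius_norm (n m : nat) (M : 'M[C]_(n, m)) : R :=
  Num.sqrt (\sum_(i < n) \sum_(j < m) normc (M i j) ^+ 2).

Definition transfer (n m : nat) (E A : 'M[C]_n) (B : 'M[C]_(n, m)) (z : C) :
    'M[C]_(n, m) :=
  invmx (z *: E - A) *m B.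

Definition is_support (S : nat) (zs : 'I_S -> C) (z : C) : Prop :=
  exists i : 'I_S, z = zs i.

Definition bary_den (S : nat) (zs q : 'I_S -> C) (z : C) : C :=
  \sum_(j < S) q j / (z - zs j).

Definition bary_num (S n m : nat) (zs q : 'I_S -> C) (F : C -> 'M[C]_(n, m))
    (z : C) : 'M[C]_(n, m) :=
  \sum_(j < S) (q j / (z - zs j)) *: F (zs j).

(* f with its removable discontinuities at the support points removed.  The
   limit is over the punctured neighbourhoods of z, so that the values of f at
   the support points, where x^-1 is evaluated at 0, are irrelevant. *)
Definition fill_support (S : nat) (zs : 'I_S -> C) (T : ptopologicalType)
    (f : C -> T) (z : C) : T :=
  if `[< is_support zs z >] then lim (f w @[w --> z^']) else f z.

Definition bary_interp (S n m : nat) (zs q : 'I_S -> C)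
    (F : C -> 'M[C]_(n, m)) : C -> 'M[C]_(n, m) :=
  fill_support zs
    (fun z => (bary_den zs q z)^-1 *: bary_num zs q F z).

Definition inv_abs_den (S : nat) (zs q : 'I_S -> C) : C -> R :=
  fill_support zs (fun z => (normc (bary_den zs q z))^-1).

Definition relative_residual (n m : nat) (E A : 'M[C]_n) (B : 'M[C]_(n, m))
    (H : C -> 'M[C]_(n, m)) (z : C) : R :=
  frobenius_norm ((z *: E - A) *m H z - B) / frobenius_norm B.

(* The second disjunct is the non-pole condition; at a support point
   bary_den takes a junk value, hence the first disjunct. *)
Definition admissible (S : nat) (zs q : 'I_S -> C) (z : C) : Prop :=
  is_support zs z \/ bary_den zs q z != 0.

End Definitions.

(* Main.v *)
(* Since (z E - A) G(w) = (z - w) E G(w) + B, multiplying the barycentric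
   numerator by z E - A cancels every factor 1 / (z - z_j), and the residual is
   the constant matrix sum_j q_j E G(z_j) divided by the barycentric
   denominator.  At a support point z_i both sides vanish: after
   multiplication by w - z_i, numerator and denominator tend to q_i G(z_i) and
   q_i as w tends to z_i. *)
Require Import Defs.
From HB Require Import structures.
From mathcomp Require Import all_boot all_order all_algebra.
From mathcomp Require Import complex.
From mathcomp Require Import all_classical all_reals all_analysis.

Import Order.TTheory GRing.Theory Num.Theory.
Import numFieldNormedType.Exports.
Import ComplexField.Normc.

Local Open Scope ring_scope.
Local Open Scope complex_scope.

Section BarycentricLimits.
Local Open Scope classical_set_scope.
Context {K : numFieldType} {S : nat}.
Variables (zs q : 'I_S -> K) (i : 'I_S).
Hypotheses (zs_inj : injective zs) (qi_neq0 : q i != 0).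

Lemma near_dnbhs_subr_neq0 : \forall w \near (zs i)^', w - zs i != 0.
Proof.
by near=> w; rewrite subr_eq0; near: w; exact: nbhs_dnbhs_neq.
Unshelve. all: by end_near. Qed.

Lemma cvg_dnbhs_subr (c : K) : w - c @[w --> (zs i)^'] --> zs i - c.
Proof.
by apply: cvgB; [exact: (@nbhs_dnbhs _ (zs i)) | exact: cvg_cst].
Qed.

(** The factor [w - zs i] turns term [i] into the constant [q i *: F i]. The other terms converge at
    [zs i], since the nodes are distinct, so the factor sends them to 0. *)
Lemma cvg_bary_num_dnbhs (V : normedModType K) (F : 'I_S -> V) :
  (w - zs i) *: (\sum_(j < S) (q j / (w - zs j)) *: F j)
    @[w --> (zs i)^'] --> q i *: F i.
Proof.
pose tail w := \sum_(j < S | j != i) (q j / (w - zs j)) *: F j.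
apply: (@cvg_trans _
    ((q i *: F i + (w - zs i) *: tail w) @[w --> (zs i)^'])).
  apply: near_eq_cvg; near=> w.
  have wi : w - zs i != 0 by near: w; exact: near_dnbhs_subr_neq0.
  by rewrite (bigD1 i)//= scalerDr scalerA mulrCA mulfV// mulr1.
suff tail0 : (w - zs i) *: tail w @[w --> (zs i)^'] --> 0 *: tail (zs i).
  have := cvgD (cvg_cst (q i *: F i)) tail0.
  by rewrite scale0r addr0; exact.
apply: cvgZ; first by rewrite -(subrr (zs i)); exact: cvg_dnbhs_subr.
apply: cvg_big => [|j ji]; first exact: add_continuous.
apply: cvgZ; last exact: cvg_cst.
apply: cvgM; first exact: cvg_cst.
apply: cvgV; last exact: cvg_dnbhs_subr.
by rewrite subr_eq0 (inj_eq zs_inj) eq_sym.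
Unshelve. all: by end_near. Qed.

Lemma cvg_bary_den_dnbhs :
  (w - zs i) * (\sum_(j < S) q j / (w - zs j)) @[w --> (zs i)^'] --> q i.
Proof.
(* The denominator is the numerator of the constant function 1, with [K] seen as a normed module
   over itself. *)
have := @cvg_bary_num_dnbhs K^o (fun=> 1).
under eq_fun do under eq_bigr do rewrite scaler1.
by rewrite scaler1.
Qed.

(** Near [zs i] the inverse is [w - zs i] times the inverse of the rescaled denominator, so it tends
    to [0 * (q i)^-1]. *)
Lemma cvg_inv_bary_den :
  (\sum_(j < S) q j / (w - zs j))^-1 @[w --> (zs i)^'] --> (0 : K).
Proof.
apply: (@cvg_trans _ (((w - zs i) *
    ((w - zs i) * (\sum_(j < S) q j / (w - zs j)))^-1) @[w --> (zs i)^'])).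
  apply: near_eq_cvg; near=> w.
  have wi : w - zs i != 0 by near: w; exact: near_dnbhs_subr_neq0.
  by rewrite invfM mulVKf.
have := cvgM (cvg_dnbhs_subr (zs i)) (cvgV qi_neq0 cvg_bary_den_dnbhs).
by rewrite subrr mul0r; exact.
Unshelve. all: by end_near. Qed.

Lemma cvg_bary_quotient (V : normedModType K) (F : 'I_S -> V) :
  (\sum_(j < S) q j / (w - zs j))^-1 *:
    (\sum_(j < S) (q j / (w - zs j)) *: F j) @[w --> (zs i)^'] --> F i.
Proof.
apply: (@cvg_trans _ ((((w - zs i) * (\sum_(j < S) q j / (w - zs j)))^-1 *:
    ((w - zs i) *: (\sum_(j < S) (q j / (w - zs j)) *: F j)))
    @[w --> (zs i)^'])).
  apply: near_eq_cvg; near=> w.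
  have wi : w - zs i != 0 by near: w; exact: near_dnbhs_subr_neq0.
  by rewrite scalerA invfM mulrAC mulVf// mul1r.
have -> : F i = (q i)^-1 *: (q i *: F i) by rewrite scalerA mulVf// scale1r.
apply: cvgZ; last exact: cvg_bary_num_dnbhs.
by apply: cvgV => //; exact: cvg_bary_den_dnbhs.
Unshelve. all: by end_near. Qed.

End BarycentricLimits.

Lemma normc_ge0 (R : rcfType) (c : R[i]) : 0 <= normc c.
Proof. by case: c => x y; exact: sqrtr_ge0. Qed.

Lemma frobenius_normZ (R : realType) (n m : nat) (c : R[i])
    (M : 'M[R[i]]_(n, m)) :
  frobenius_norm (c *: M) = normc c * frobenius_norm M.
Proof.
rewrite /frobenius_norm; under eq_bigr => i _.
  under eq_bigr do rewrite mxE normcM exprMn.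
  rewrite -mulr_sumr.
  over.
by rewrite -mulr_sumr sqrtrM ?sqr_ge0// sqrtr_sqr ger0_norm ?normc_ge0.
Qed.

Lemma frobenius_norm0 (R : realType) (n m : nat) :
  frobenius_norm (0 : 'M[R[i]]_(n, m)) = 0.
Proof. by rewrite -(scale0r 0) frobenius_normZ normc0 mul0r. Qed.

(** Split [z *: E - A] as [(z - w) *: E + (w *: E - A)]; the second summand cancels the inverse
    inside [transfer E A B w]. *)
Lemma mul_pencil_transfer {R : realType} {n m : nat} (E A : 'M[R[i]]_n)
    (B : 'M[R[i]]_(n, m)) (z w : R[i]) : w *: E - A \in unitmx ->
  (z *: E - A) *m transfer E A B w = (z - w) *: (E *m transfer E A B w) + B.
Proof.
move=> reg; rewrite -[X in _ = _ + X](mulKVmx reg B) scalemxAl -mulmxDl.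
by rewrite scalerBl addrA subrK.
Qed.

Theorem proposition1 (R : realType) (n m S : nat)
    (E A : 'M[R[i]]_n) (B : 'M[R[i]]_(n, m)) (hB : B != 0)
    (zs q : 'I_S -> R[i])
    (hz : injective zs)
    (hreg : forall j : 'I_S, zs j *: E - A \in unitmx)
    (hq : forall j : 'I_S, q j != 0) :
  exists gamma : R, forall z : R[i], admissible zs q z ->
    relative_residual E A B (bary_interp zs q (transfer E A B)) z
    = gamma * inv_abs_den zs q z.
Proof.
pose W := \sum_(j < S) q j *: (E *m transfer E A B (zs j)).
exists (frobenius_norm W / frobenius_norm B) => z adm.
rewrite /relative_residual /bary_interp /inv_abs_den /fill_support.
case: asboolP => [[i ->]|zNsupp].
  have -> : lim ((normc (bary_den zs q w))^-1 @[w --> (zs i)^'])%classic = 0.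
    apply: cvg_lim => //; apply/cvgr0Pnorm_lt => e e0.
    (* The norm on [R[i]] takes values in [R[i]], so the real bound [e] is embedded there to use the
       complex limit, and [ltcR] brings the estimate back. *)
    have e0' : 0 < e%:C by rewrite ltcR.
    have {e0'} := cvgr0_norm_lt _ (cvg_inv_bary_den zs q i hz (hq i)) _ e0'.
    move/(_ _)/filterS; apply => w den_lt.
    by rewrite -normcV ger0_norm ?normc_ge0// -ltcR.
  have -> : lim (((bary_den zs q w)^-1 *:
      bary_num zs q (transfer E A B) w) @[w --> (zs i)^'])%classic
    = transfer E A B (zs i).
    apply: cvg_lim; first exact: norm_hausdorff.
    exact: (cvg_bary_quotient zs q i hz (hq i) _
      (fun j => transfer E A B (zs j))).
  (* With [z = w = zs i] the term in [E] vanishes, so the residual is exactly 0. *)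
  by rewrite mul_pencil_transfer// subrr scale0r add0r subrr
    frobenius_norm0 mul0r mulr0.
have den0 : bary_den zs q z != 0 by case: adm.
rewrite -normcV mulrAC; congr (_ / _).
(* By homogeneity of the norm, it suffices that the residual matrix equals
   [(bary_den zs q z)^-1 *: W]. *)
rewrite mulrC -frobenius_normZ; congr (frobenius_norm _).
have zNzs j : z - zs j != 0.
  by rewrite subr_eq0; apply/eqP => zE; apply: zNsupp; exists j.
(* Writing [B] as the inverse denominator times the denominator times [B] lets the subtraction be
   done term by term, where the multiples of [B] cancel. *)
rewrite -scalemxAr -[X in _ - X](scalerK den0) -scalerBr; congr (_ *: _).
rewrite mulmx_sumr scaler_suml -sumrB; apply: eq_bigr => j _.
rewrite -scalemxAr mul_pencil_transfer// scalerDr addrK scalerA.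
by rewrite divfK.
Qed.
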